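(* Assume $\mathrm{MA}_{\sigma\text{-centered}}(\kappa)$. Let $\mathbb B$ be a Boolean algebra of size $\kappa$ and let $e:\mathbb B\to\mathcal P(\mathbb N)/\mathrm{fin}$ be an embedding which lifts, i.e. there is a Boolean algebra homomorphism $E:\mathbb B\to\mathcal P(\mathbb N)$ with $E(B)\in e(B)$ for every $B\in\mathbb B$. Then every automorphism $h$ of $\mathbb B$ extends to an automorphism of $\mathcal P(\mathbb N)/\mathrm{fin}$, i.e. there is an automorphism $\bar h$ of $\mathcal P(\mathbb N)/\mathrm{fin}$ with $\bar h\circ e=e\circ h$.
   Context: $\mathcal P(\mathbb N)/\mathrm{fin}$ is the Boolean algebra of subsets of $\mathbb N$ modulo the ideal of finite sets; elements are equivalence classes $[X]$. An embedding of Boolean algebras is an injective Boolean homomorphism. $\mathrm{MA}_{\sigma\text{-centered}}(\kappa)$ is the statement: for every $\sigma$-centered partial order $\mathbb P$ and every family of at most $\kappa$ dense subsets of $\mathbb P$ there is a filter on $\mathbb P$ meeting all of them. *)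

(* Defs.v *)
From HB Require Import structures.
From mathcomp Require Import all_boot all_order generic_quotient.
From mathcomp Require Import boolp classical_sets functions cardinality.

Set Implicit Arguments.
Unset Strict Implicit.
Unset Printing Implicit Defensive.

Import Order.Theory.

Local Open Scope classical_set_scope.
Local Open Scope quotient_scope.

(* Boolean algebras are MathComp's complemented distributive lattices with top
   and bottom; [set nat] is one canonically, ordered by inclusion. Beware that
   [{tblmorphism A -> B}] would be wrong for homomorphisms: that structure only
   asks for the preservation of [\bot] and [\top], not of meets and joins. *)
Section BooleanHom.
Variables (d d' : Order.disp_t).
Variables (A : ctbDistrLatticeType d) (B : ctbDistrLatticeType d').

Definition boolean_hom (f : A -> B) : Prop :=
  [/\ {morph f : x y / (x `&` y)%O}, {morph f : x y / (x `|` y)%O},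
      {morph f : x / (~` x)%O}, f \bot%O = \bot%O & f \top%O = \top%O].

Definition boolean_embedding (f : A -> B) : Prop :=
  boolean_hom f /\ injective f.

End BooleanHom.

Definition boolean_automorphism d (A : ctbDistrLatticeType d) (f : A -> A) :=
  boolean_hom f /\ bijective f.

Section PNfin.

Definition eqfin (A B : set nat) : bool := `[< finite_set (A `+` B) >].

Lemma eqfinP (A B : set nat) : reflect (finite_set (A `+` B)) (eqfin A B).
Proof. exact: asboolP. Qed.

Lemma eqfin_refl : reflexive eqfin.
Proof. by move=> A; apply/eqfinP; rewrite setYK; exact: finite_set0. Qed.

Lemma eqfin_sym : symmetric eqfin.
Proof. by move=> A B; rewrite /eqfin setYC. Qed.

Lemma eqfin_trans : transitive eqfin.
Proof.
move=> B A C /eqfinP AB /eqfinP BC; apply/eqfinP.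
have : finite_set ((A `+` B) `|` (B `+` C)) by rewrite finite_setU.
apply: sub_finite_set => n /= [[An Cn]|[Cn An]]; have [Bn|Bn] := pselect (B n).
- by right; left.
- by left; left.
- by left; right.
- by right; right.
Qed.

Canonical eqfin_equiv := EquivRel eqfin eqfin_refl eqfin_sym eqfin_trans.

Definition PNfin := {eq_quot eqfin}.

HB.instance Definition _ := Choice.on PNfin.
HB.instance Definition _ := EqQuotient.on PNfin.

Lemma PNfinP (A B : set nat) :
  \pi_PNfin A = \pi_PNfin B <-> finite_set (A `+` B).
Proof. by split => [/eqmodP/eqfinP|h]; last by apply/eqmodP/eqfinP. Qed.

Definition PNfin_meet := lift_op2 PNfin (@setI nat).
Definition PNfin_join := lift_op2 PNfin (@setU nat).
Definition PNfin_compl := lift_op1 PNfin (@setC nat).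
Definition PNfin_le (x y : PNfin) : bool := `[< finite_set (repr x `\` repr y) >].
Definition PNfin_lt (x y : PNfin) : bool := (y != x) && PNfin_le x y.

Lemma finite_repr (A : set nat) : finite_set (A `+` repr (\pi_PNfin A)).
Proof. by apply/PNfinP; rewrite reprK. Qed.

Lemma PNfin_meetE (A B : set nat) :
  PNfin_meet (\pi_PNfin A) (\pi_PNfin B) = \pi_PNfin (A `&` B).
Proof.
unlock PNfin_meet; apply/esym/PNfinP.
have : finite_set ((A `+` repr (\pi_PNfin A)) `|` (B `+` repr (\pi_PNfin B))).
  by rewrite finite_setU; split; exact: finite_repr.
apply: sub_finite_set => n /=.
by have := (EM (A n), EM (repr (\pi_PNfin A) n), EM (B n),
  EM (repr (\pi_PNfin B) n)); tauto.
Qed.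

Lemma PNfin_joinE (A B : set nat) :
  PNfin_join (\pi_PNfin A) (\pi_PNfin B) = \pi_PNfin (A `|` B).
Proof.
unlock PNfin_join; apply/esym/PNfinP.
have : finite_set ((A `+` repr (\pi_PNfin A)) `|` (B `+` repr (\pi_PNfin B))).
  by rewrite finite_setU; split; exact: finite_repr.
apply: sub_finite_set => n /=.
by have := (EM (A n), EM (repr (\pi_PNfin A) n), EM (B n),
  EM (repr (\pi_PNfin B) n)); tauto.
Qed.

Lemma PNfin_complE (A : set nat) :
  PNfin_compl (\pi_PNfin A) = \pi_PNfin (~` A).
Proof.
unlock PNfin_compl; apply/esym/PNfinP.
have := finite_repr A; apply: sub_finite_set => n /=.
by have := (EM (A n), EM (repr (\pi_PNfin A) n)); tauto.
Qed.

Lemma PNfin_le_def (x y : PNfin) : PNfin_le x y = (PNfin_meet x y == x).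
Proof.
apply/asboolP/eqP => [xy|].
  unlock PNfin_meet; rewrite -[RHS]reprK; apply/PNfinP.
  by apply: sub_finite_set xy => n /=; tauto.
unlock PNfin_meet; rewrite -[RHS]reprK => /PNfinP.
by apply: sub_finite_set => n /=; tauto.
Qed.

Lemma PNfin_lt_def (x y : PNfin) : PNfin_lt x y = (y != x) && PNfin_le x y.
Proof. by []. Qed.

Lemma PNfin_meetC : commutative PNfin_meet.
Proof.
elim/quotW => A; elim/quotW => B.
by rewrite !PNfin_meetE setIC.
Qed.

Lemma PNfin_joinC : commutative PNfin_join.
Proof.
elim/quotW => A; elim/quotW => B.
by rewrite !PNfin_joinE setUC.
Qed.

Lemma PNfin_meetA : associative PNfin_meet.
Proof.
elim/quotW => A; elim/quotW => B; elim/quotW => C.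
by rewrite !PNfin_meetE setIA.
Qed.

Lemma PNfin_joinA : associative PNfin_join.
Proof.
elim/quotW => A; elim/quotW => B; elim/quotW => C.
by rewrite !PNfin_joinE setUA.
Qed.

Lemma PNfin_joinKI (y x : PNfin) : PNfin_meet x (PNfin_join x y) = x.
Proof.
elim/quotW: x => A; elim/quotW: y => B.
by rewrite PNfin_joinE PNfin_meetE setUC setKU.
Qed.

Lemma PNfin_meetKU (y x : PNfin) : PNfin_join x (PNfin_meet x y) = x.
Proof.
elim/quotW: x => A; elim/quotW: y => B.
by rewrite PNfin_meetE PNfin_joinE setIC setKI.
Qed.

Lemma PNfin_meetUl : left_distributive PNfin_meet PNfin_join.
Proof.
elim/quotW => A; elim/quotW => B; elim/quotW => C.
by rewrite !(PNfin_joinE, PNfin_meetE) setIUl.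
Qed.

Lemma PNfin_meetxx : idempotent_op PNfin_meet.
Proof. by elim/quotW => A; rewrite PNfin_meetE setIid. Qed.

Fact PNfin_display : Order.disp_t. Proof. by []. Qed.

HB.instance Definition _ := Order.isMeetJoinDistrLattice.Build PNfin_display
  PNfin PNfin_le_def PNfin_lt_def PNfin_meetC PNfin_joinC PNfin_meetA
  PNfin_joinA PNfin_joinKI PNfin_meetKU PNfin_meetUl PNfin_meetxx.

Lemma PNfin_le0x (x : PNfin) : (\pi_PNfin set0 <= x)%O.
Proof. by elim/quotW: x => A; rewrite leEmeet [Order.meet _ _]PNfin_meetE set0I. Qed.

Lemma PNfin_lex1 (x : PNfin) : (x <= \pi_PNfin setT)%O.
Proof. by elim/quotW: x => A; rewrite leEmeet [Order.meet _ _]PNfin_meetE setIT. Qed.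

HB.instance Definition _ :=
  Order.hasBottom.Build PNfin_display PNfin PNfin_le0x.
HB.instance Definition _ := Order.hasTop.Build PNfin_display PNfin PNfin_lex1.

Lemma PNfin_joinxC (x : PNfin) : (x `|` PNfin_compl x = \top)%O.
Proof.
by elim/quotW: x => A; rewrite PNfin_complE [LHS]PNfin_joinE setUv.
Qed.

Lemma PNfin_meetxC (x : PNfin) : (x `&` PNfin_compl x = \bot)%O.
Proof.
by elim/quotW: x => A; rewrite PNfin_complE [LHS]PNfin_meetE setICr.
Qed.

HB.instance Definition _ := Order.TBDistrLattice_hasComplement.Build
  PNfin_display PNfin PNfin_joinxC PNfin_meetxC.

End PNfin.

(* [\pi_PNfin X = x] says that the set [X] belongs to the class [x]. *)
Definition lifts d (B : ctbDistrLatticeType d) (e : B -> PNfin) : Prop :=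
  exists2 E : B -> set nat, boolean_hom E & forall b, \pi_PNfin (E b) = e b.

Section MartinAxiom.
Variables (d : Order.disp_t) (P : porderType d).

Definition dense_subset (D : set P) := forall p, exists2 q, D q & (q <= p)%O.

Definition centered (C : set P) :=
  forall F : set P, finite_set F -> F `<=` C -> lbound F !=set0.

Definition order_filter (G : set P) :=
  [/\ G !=set0,
      forall p q, G p -> (p <= q)%O -> G q &
      forall p q, G p -> G q -> exists r, [/\ G r, (r <= p)%O & (r <= q)%O]].

End MartinAxiom.

Definition sigma_centered d (P : porderType d) :=
  exists2 C : nat -> set P,
    forall n, centered (C n) & \bigcup_n C n = [set: P].

(* The cardinal kappa is given by a type [K] of that cardinality. *)
Definition MA_sigma_centered (K : Type) : Prop :=
  forall (d : Order.disp_t) (P : porderType d),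
    [set: P] !=set0 -> sigma_centered P ->
  forall D : set (set P), (D #<= [set: K])%card ->
    (forall A, D A -> dense_subset A) ->
  exists2 G : set P, order_filter G & forall A, D A -> G `&` A !=set0.

(* Main.v *)
(* Let E lift e. A generic filter for finite partial injections of nat with
   finite side sets F of elements of B, where new pairs (n, m) must satisfy
   n \in E b <-> m \in E (h b) for all b in F, gives a permutation of nat carrying
   E b onto E (h b) up to finitely many points for all b; it induces hbar. Domain
   and range can be extended because the atom a of the subalgebra generated by F
   with n \in E a is nonzero, so that E (h a) is infinite. Conditions with the
   same finite injection are compatible, whence sigma-centeredness. If K is
   finite it does not provide enough dense sets for totality and surjectivity,
   but then B is finite and MA for countably many dense sets, a theorem of ZFC,
   is enough. *)
From HB Require Import structures.
Require Import Defs.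
From mathcomp Require Import all_boot all_order generic_quotient.
From mathcomp Require Import boolp classical_sets functions cardinality.

Set Implicit Arguments.
Unset Strict Implicit.
Unset Printing Implicit Defensive.

Import Order.TTheory.

Local Open Scope classical_set_scope.
Local Open Scope quotient_scope.

(** * Surjections from cardinal inequalities, and the countable case of Martin's axiom *)

Lemma card_le_surjection (T : choiceType) (t0 : T) (U : Type) :
  ([set: T] #<= [set: U])%card -> exists g : U -> T, forall t, exists u, g u = t.
Proof.
pose Tp : pointedType := HB.pack (Choice.sort T) (isPointed.Build T t0).
move=> /(@pcard_surjP Tp)[g gT]; exists g => t.
by have [u _ <-] := gT t I; exists u.
Qed.

(* Rasiowa-Sikorski *)
Lemma MA_nat : MA_sigma_centered nat.
Proof.
move=> d P [p0 _] _ D /pcard_injP[i iD] Ddense.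
(* The first component counts stages: stage [n] enters the dense set numbered [n], at most one since
   [i] is injective, and does nothing if there is none. *)
have step (np : nat * P) : {mq : nat * P | mq.1 = np.1.+1 /\ (mq.2 <= np.2)%O /\
    forall A, D A -> i A = np.1 -> A mq.2}.
  apply/cid; case: np => n p /=.
  have [[A [DA iA]]|noA] := pselect (exists A, D A /\ i A = n).
    have [q Aq qp] := Ddense A DA p.
    exists (n.+1, q); split=> //; split=> // A' DA' iA'.
    suff -> : A' = A by [].
    by apply: iD; rewrite ?inE // iA' iA.
  by exists (n.+1, p); split=> //; split=> // A DA iA; case: noA; exists A.
have [s [s0 sS]] := dependent_choice step (0, p0).
have s1 n : (s n).1 = n.
  by elim: n => [|n IHn]; rewrite ?s0 //; have [-> _] := sS n; rewrite IHn.
have s_mono m n : m <= n -> ((s n).2 <= (s m).2)%O.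
  elim: n => [|n IHn]; first by rewrite leqn0 => /eqP ->.
  rewrite leq_eqVlt => /predU1P[-> //|/IHn]; apply: le_trans.
  by have [_ []] := sS n.
exists [set q | exists n, ((s n).2 <= q)%O]; first split.
- by exists p0, 0; rewrite s0.
- by move=> p q [n snp] pq; exists n; exact: le_trans pq.
- move=> p q [m smp] [n snq]; exists (s (maxn m n)).2; split.
  + by exists (maxn m n).
  + by apply: le_trans smp; apply: s_mono; rewrite leq_maxl.
  + by apply: le_trans snq; apply: s_mono; rewrite leq_maxr.
move=> A DA; exists (s (i A).+1).2; split; first by exists (i A).+1.
by have [_ [_ H]] := sS (i A); apply: H; rewrite ?s1.
Qed.

Lemma uniq_map_inj (T U : eqType) (f : T -> U) (s : seq T) :
  uniq (map f s) -> {in s &, injective f}.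
Proof.
elim: s => [//|a s IHs] /= /andP[fa /IHs fs] x y.
rewrite !inE => /predU1P[->|xs] /predU1P[->|ys] //; last exact: fs.
- by move=> fay; rewrite fay map_f in fa.
- by move=> fxa; rewrite -fxa map_f in fa.
Qed.

(** * The forcing notion *)

(** Duplicate-free coordinates make the list of pairs a finite partial injection. Being boolean, the
    predicate has unique proofs, so a condition is determined by its two components. *)
Definition condition_ok (B : choiceType) (x : seq (nat * nat) * set B) : bool :=
  [&& uniq (map fst x.1), uniq (map snd x.1) & `[< finite_set x.2 >]].

Definition respects (B : Type) (f g : B -> set nat) (b : B) (nm : nat * nat) :=
  f b nm.1 <-> g b nm.2.

(* The parameters [f] and [g] only serve to attach the order to the type. *)
Definition condition (B : choiceType) (f g : B -> set nat) : Type :=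
  {x : seq (nat * nat) * set B | condition_ok x}.

HB.instance Definition _ (B : choiceType) (f g : B -> set nat) :=
  Choice.on (condition f g).

Section ForcingOrder.
Variables (B : choiceType) (f g : B -> set nat).
Local Notation P := (condition f g).
Local Notation respects := (respects f g).

Definition graph (x : P) : seq (nat * nat) := (val x).1.
Definition promises (x : P) : set B := (val x).2.

Lemma graph_uniq1 (x : P) : uniq (map fst (graph x)).
Proof. by have /and3P[] := valP x. Qed.

Lemma graph_uniq2 (x : P) : uniq (map snd (graph x)).
Proof. by have /and3P[] := valP x. Qed.

Lemma promises_finite (x : P) : finite_set (promises x).
Proof. by have /and3P[_ _ /asboolP] := valP x. Qed.

Lemma conditionE (s : seq (nat * nat)) (F : set B) :
  uniq (map fst s) -> uniq (map snd s) -> finite_set F ->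
  exists x : P, graph x = s /\ promises x = F.
Proof.
move=> s1 s2 Ffin.
have ok : condition_ok (s, F) by apply/and3P; split=> //; exact/asboolP.
by exists (exist _ (s, F) ok).
Qed.

(** New pairs are prepended, so antisymmetry holds for lists and not just for their sets of pairs. A
    promise of [x] binds only the pairs added after it. *)
Definition condition_ext (y x : P) : Prop :=
  promises x `<=` promises y /\
  exists2 r, graph y = r ++ graph x &
    forall b nm, promises x b -> nm \in r -> respects b nm.

Definition condition_le (y x : P) : bool := `[< condition_ext y x >].

Lemma condition_le_refl : reflexive condition_le.
Proof. by move=> x; apply/asboolP; split=> //; exists [::]. Qed.

Lemma condition_le_anti : antisymmetric condition_le.
Proof.
move=> x y /andP[/asboolP[yx [r xE _]] /asboolP[xy [r' yE _]]].
apply: val_inj; rewrite [val x]surjective_pairing [val y]surjective_pairing.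
congr pair; last by apply/seteqP; split.
have r0 : r = [::].
  apply/nilP; rewrite /nilp -leqn0 -(leq_add2r (size (graph y))) add0n.
  by rewrite -size_cat -xE yE size_cat leq_addl.
by move: xE; rewrite r0.
Qed.

Lemma condition_le_trans : transitive condition_le.
Proof.
move=> y z x /asboolP[yz [r zE rP]] /asboolP[xy [r' yE r'P]].
apply/asboolP; split; first exact: subset_trans yz.
exists (r ++ r'); first by rewrite zE yE catA.
move=> b nm xb; rewrite mem_cat => /orP[nmr|]; last exact: r'P.
by apply: rP => //; exact: xy.
Qed.

Fact condition_display : Order.disp_t. Proof. by []. Qed.

HB.instance Definition _ := Order.Le_isPOrder.Build condition_display P
  condition_le_refl condition_le_anti condition_le_trans.

Lemma condition_sigma_centered : sigma_centered P.
Proof.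
exists (fun n => [set x | pickle (graph x) = n]); last first.
  by apply/seteqP; split=> // x _; exists (pickle (graph x)).
move=> n F Ffin FC; have [->|/set0P[x0 Fx0]] := eqVneq F set0.
  have [x _] := @conditionE [::] set0 isT isT (finite_set0 B).
  by exists x => y.
have graphF x : F x -> graph x = graph x0.
  by move=> Fx; apply: (pcan_inj pickleK); rewrite FC // FC.
(* Uniting the promises over the common graph adds no pair, so there is nothing to respect. *)
have [z [zg zp]] := @conditionE (graph x0) (\bigcup_(x in F) promises x)
  (graph_uniq1 x0) (graph_uniq2 x0)
  (bigcup_finite Ffin (fun x _ => promises_finite x)).
exists z => x Fx; apply/asboolP; split; first by rewrite zp; exact: bigcup_sup.
by exists [::] => //; rewrite zg graphF.
Qed.

End ForcingOrder.

(* Take [m] in [g a], where [a] is the meet of the [b] in [s] with [f b n] and of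
   the [~` b] for the others: [f a n] holds, so [g a] is infinite. *)
Lemma respectful_partner d (B : ctbDistrLatticeType d) (f g : B -> set nat)
    (fg : forall b, f b !=set0 -> infinite_set (g b))
    (fh : boolean_hom f) (gh : boolean_hom g) (s : seq B) (A : set nat) (n : nat) :
  finite_set A -> exists2 m, ~ A m & forall b, b \in s -> f b n <-> g b m.
Proof.
case: fh => fI _ fC _ f1; case: gh => gI _ gC _ _ Afin.
have [a an aP] : exists2 a, f a n &
    forall m, g a m -> forall b, b \in s -> f b n <-> g b m.
  elim: s => [|b s [a an aP]]; first by exists \top%O; rewrite ?f1.
  have [bn|bn] := pselect (f b n).
    exists (b `&` a)%O; first by rewrite fI.
    move=> m; rewrite gI => -[bm am] c; rewrite inE => /predU1P[->|]; first by split.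
    exact: aP.
  exists (~` b `&` a)%O; first by rewrite fI fC.
  move=> m; rewrite gI gC => -[bm am] c; rewrite inE => /predU1P[->|]; first by split.
  exact: aP.
have : infinite_set (g a `\` A) by apply: infinite_setD => //; apply: fg; exists n.
by move=> /infinite_setN0[m [am Am]]; exists m => //; exact: aP.
Qed.

(** * Density arguments and the generic bijection *)

Section GenericBijection.
Variables (d : Order.disp_t) (B : ctbDistrLatticeType d) (f g : B -> set nat).
Hypotheses (fh : boolean_hom f) (gh : boolean_hom g).
Hypotheses (fg : forall b, f b !=set0 -> infinite_set (g b)).
Hypotheses (gf : forall b, g b !=set0 -> infinite_set (f b)).
Local Notation P := (condition f g).

Lemma extend_promises (x : P) (b : B) :
  exists2 y : P, (y <= x)%O & promises y b.
Proof.
have [y [yg yp]] := @conditionE _ f g (graph x) (promises x `|` [set b])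
  (graph_uniq1 x) (graph_uniq2 x)
  ltac:(by rewrite finite_setU; split; [exact: promises_finite | exact: finite_set1]).
exists y; last by rewrite yp; right.
apply/asboolP; split; first by rewrite yp; exact: subsetUl.
by exists [::]; rewrite // yg.
Qed.

Lemma extend_graph (x : P) (n m : nat) :
  n \notin map fst (graph x) -> m \notin map snd (graph x) ->
  (forall b, promises x b -> respects f g b (n, m)) ->
  exists2 y : P, (y <= x)%O & (n, m) \in graph y.
Proof.
move=> nx mx nm.
have [y [yg yp]] := @conditionE _ f g ((n, m) :: graph x) (promises x)
  ltac:(by rewrite /= nx graph_uniq1) ltac:(by rewrite /= mx graph_uniq2)
  (promises_finite x).
exists y; last by rewrite yg mem_head.
apply/asboolP; split; first by rewrite yp.
exists [:: (n, m)]; first by rewrite yg.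
by move=> b nm'; rewrite inE => /[swap] /eqP ->; exact: nm.
Qed.

Lemma extend_domain (x : P) (n : nat) :
  exists2 y : P, (y <= x)%O & n \in map fst (graph y).
Proof.
have [nx|nx] := boolP (n \in map fst (graph x)); first by exists x.
have /finite_seqP[s sE] := promises_finite x.
have [m mx mP] := respectful_partner fg fh gh s n
  (finite_seq (map snd (graph x))).
have [||y yx ynm] := @extend_graph x n m nx; first exact/negP.
  by rewrite sE => b /= /mP.
by exists y => //; apply/mapP; exists (n, m).
Qed.

Lemma extend_codomain (x : P) (m : nat) :
  exists2 y : P, (y <= x)%O & m \in map snd (graph y).
Proof.
have [mx|mx] := boolP (m \in map snd (graph x)); first by exists x.
have /finite_seqP[s sE] := promises_finite x.
have [n nx nP] := respectful_partner gf gh fh s m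
  (finite_seq (map fst (graph x))).
have [||y yx ynm] := @extend_graph x n m _ mx; first exact/negP.
  by rewrite sE => b /= /nP; rewrite /respects; tauto.
by exists y => //; apply/mapP; exists (n, m).
Qed.

Lemma generic_bijection (K : Type) (k1 : K -> B) (k2 : K -> nat) :
  MA_sigma_centered K ->
  (forall b, exists k, k1 k = b) -> (forall n, exists k, k2 k = n) ->
  exists2 t : nat -> nat, bijective t &
    forall b, finite_set ((t @^-1` f b) `+` g b).
Proof.
move=> MA k1P k2P.
(* One index [k] serves an element of [B] and a number at once, so a family indexed by [K] covers
   all requirements without cardinal arithmetic. *)
pose D k := [set x : P | [/\ promises x (k1 k),
  k2 k \in map fst (graph x) & k2 k \in map snd (graph x)]].
have P0 : [set: P] !=set0.
  by have [x _] := @conditionE _ f g [::] set0 isT isT (finite_set0 B); exists x.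
have le_graph (y x : P) : (y <= x)%O -> {subset graph x <= graph y}.
  by move=> /asboolP[_ [r -> _]] nm; rewrite mem_cat orbC => ->.
have [_ [k _ <-]|G [_ _ Gdir] GD] :=
    MA _ P P0 (condition_sigma_centered f g) (range D) (card_image_le _ _).
  move=> x; have [y yx yk] := extend_promises x (k1 k).
  have [z zy zk] := extend_domain y (k2 k).
  have [w wz wk] := extend_codomain z (k2 k).
  exists w; last exact: le_trans (le_trans wz zy) yx.
  split=> //; first by have /asboolP[zw _] := le_trans wz zy; exact: zw.
  have /mapP[nm nmz ->] := zk.
  by apply: map_f; exact: le_graph nmz.
(* The union of the graphs in [G]; directedness places any two of its pairs in a single condition,
   which makes it injective and single-valued. *)
pose R (n m : nat) := exists2 x : P, G x & (n, m) \in graph x.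
have Rcommon n m n' m' : R n m -> R n' m' ->
    exists x : P, (n, m) \in graph x /\ (n', m') \in graph x.
  move=> [x Gx xnm] [y Gy ynm]; have [z [_ zx zy]] := Gdir x y Gx Gy.
  by exists z; split; [exact: le_graph xnm | exact: le_graph ynm].
have Rfun n n' m : R n m -> R n' m -> n = n'.
  move=> Rn Rn'; have [x [xn xn']] := Rcommon _ _ _ _ Rn Rn'.
  by have [] := uniq_map_inj (graph_uniq2 x) xn xn' erefl.
have Rinj n m m' : R n m -> R n m' -> m = m'.
  move=> Rm Rm'; have [x [xm xm']] := Rcommon _ _ _ _ Rm Rm'.
  by have [] := uniq_map_inj (graph_uniq1 x) xm xm' erefl.
have Rdom n : {m | R n m}.
  apply/cid; have [k <-] := k2P n.
  have [x [Gx [_ /mapP[[n' m] nm ->] _]]] := GD (D k) (imageP D I).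
  by exists m; exists x.
have Rcod m : {n | R n m}.
  apply/cid; have [k <-] := k2P m.
  have [x [Gx [_ _ /mapP[[n m'] nm ->]]]] := GD (D k) (imageP D I).
  by exists n; exists x.
(* The bijection runs backwards, from [m] to its partner [n], because preimages under it are to
   carry [f b] to [g b]. *)
exists (fun m => sval (Rcod m)).
  exists (fun n => sval (Rdom n)) => [m|n].
    by case: (Rcod m) => n nm /=; case: (Rdom n) => m' /= nm'; exact: Rinj nm' nm.
  by case: (Rdom n) => m nm /=; case: (Rcod m) => n' /= nm'; exact: Rfun nm' nm.
move=> b; have [k kb] := k1P b.
have [x [Gx [xb _ _]]] := GD (D k) (imageP D I).
rewrite kb in xb.
(* Exceptions can only come from pairs already in [x]: any other pair of the generic bijection is
   new in a common extension of [x] and so respects [b]. *)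
apply: sub_finite_set (finite_seq (map snd (graph x))) => m /=.
case: (Rcod m) => n [y Gy ynm] /= fgb; apply/negPn/negP => mx.
have [z [_ zx zy]] := Gdir x y Gx Gy.
have /asboolP[_ [r zE rP]] := zx.
have := le_graph _ _ zy _ ynm; rewrite zE mem_cat => /orP[nmr|nmx].
  by have := rP b (n, m) xb nmr; rewrite /respects /=; tauto.
by case/negP: mx; apply/mapP; exists (n, m).
Qed.

End GenericBijection.

(** * Automorphisms induced by permutations, and the conclusion *)

Lemma preimage_automorphism (t : nat -> nat) : bijective t ->
  exists2 hbar : PNfin -> PNfin, boolean_automorphism hbar &
    forall A, hbar (\pi_PNfin A) = \pi_PNfin (t @^-1` A).
Proof.
have preimage_fin (u : nat -> nat) (A : set nat) :
    injective u -> finite_set A -> finite_set (u @^-1` A).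
  by move=> u_inj; apply: finite_preimage => x y _ _; exact: u_inj.
(* Stated for every injective [u], so that it also provides the inverse map, from the inverse
   permutation. *)
have [hb hbE] : exists hb : (nat -> nat) -> PNfin -> PNfin, forall u A,
    injective u -> hb u (\pi_PNfin A) = \pi_PNfin (u @^-1` A).
  exists (fun u x => \pi_PNfin (u @^-1` (repr x))) => u A u_inj.
  apply/esym/PNfinP.
  exact: (preimage_fin u (A `+` repr (\pi_PNfin A)) u_inj (finite_repr A)).
move=> [t' tK t'K]; have t_inj := can_inj tK.
exists (hb t); last by move=> A; exact: hbE.
have hbK u v : cancel u v -> cancel v u -> cancel (hb u) (hb v).
  move=> uK vK x; have [u_inj v_inj] := (can_inj uK, can_inj vK).
  have uvx : v @^-1` (u @^-1` repr x) = repr x.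
    by apply/funext => n; rewrite /preimage /= vK.
  by rewrite -[x]reprK !hbE // uvx.
split; last by exists (hb t'); exact: hbK.
split.
- move=> x y; rewrite -[x]reprK -[y]reprK [Order.meet _ _]PNfin_meetE !hbE //.
  by rewrite [RHS]PNfin_meetE.
- move=> x y; rewrite -[x]reprK -[y]reprK [Order.join _ _]PNfin_joinE !hbE //.
  by rewrite [RHS]PNfin_joinE.
- move=> x; rewrite -[x]reprK [Order.compl _]PNfin_complE !hbE //.
  by rewrite [RHS]PNfin_complE.
- exact: hbE.
- exact: hbE.
Qed.

Unset Implicit Arguments.

Theorem theorem2p3 (K : Type) (hMA : MA_sigma_centered K)
    (d : Order.disp_t) (B : ctbDistrLatticeType d)
    (hB : ([set: B] #= [set: K])%card)
    (e : B -> PNfin) (he : boolean_embedding e) (he_lifts : lifts e)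
    (h : B -> B) (hh : boolean_automorphism h) :
  exists hbar : PNfin -> PNfin,
    boolean_automorphism hbar /\ (forall b : B, hbar (e b) = e (h b)).
Proof.
case: he => [[_ _ _ e0 _] e_inj]; case: he_lifts => E Ehom Ee.
case: hh => [[hI hU hC h0 h1] hbij]; have h_inj := bij_inj hbij.
case: (Ehom) => EI EU EC E0 E1.
have EhE : boolean_hom (E \o h).
  by split=> [x y|x y|x||] /=; rewrite ?(hI, hU, hC, h0, h1).
(* A finite [E b] would give [e b] = [e \bot], against the injectivity of [e]. *)
have Einf b : b <> \bot%O -> infinite_set (E b).
  move=> b0 Ebfin; apply/b0/e_inj; rewrite e0 -Ee.
  by apply/PNfinP; rewrite setY0.
have E_neq0 b : E b !=set0 -> b <> \bot%O.
  by move=> [n + b0]; rewrite b0 E0.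
have fg b : E b !=set0 -> infinite_set ((E \o h) b).
  by move=> /E_neq0 b0; apply: Einf; rewrite -h0 => /h_inj.
have gf b : (E \o h) b !=set0 -> infinite_set (E b).
  by move=> /E_neq0 hb0; apply: Einf => b0; apply: hb0; rewrite b0.
(* The index type must surject onto both [B] and [nat]: [nat] itself does when [K] is finite, and
   [K] does otherwise. *)
have [K' [MA' [k1 k1P] [k2 k2P]]] : exists K', [/\ MA_sigma_centered K',
    exists k1 : K' -> B, forall b, exists k, k1 k = b &
    exists k2 : K' -> nat, forall n, exists k, k2 k = n].
  have BK : ([set: B] #<= [set: K])%card by move: hB; rewrite card_eq_le => /andP[].
  have [Kfin|/infiniteP Kinf] := pselect (finite_set [set: K]).
    exists nat; split; [exact: MA_nat | | by exists id => n; exists n].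
    apply: (card_le_surjection (\bot%O : B)).
    exact/finite_set_countable/(card_le_finite BK).
  by exists K; split=> //; apply: card_le_surjection => //; exact: \bot%O.
have [t tbij tP] := generic_bijection Ehom EhE fg gf MA' k1P k2P.
have [hbar hbar_aut hbarE] := preimage_automorphism tbij.
exists hbar; split=> // b; rewrite -!Ee hbarE; apply/PNfinP; exact: tP.
Qed.
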